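(* Let $1 \le r \le n$ be integers, let $\mathbf{A}, \mathbf{M} \in \mathbb{R}^{n\times n}$ be symmetric positive definite matrices, and let $\mathbf{Q} \in \mathbb{R}^{n \times r}$ have orthonormal columns ($\mathbf{Q}^\top\mathbf{Q} = \mathbf{I}$). Let $\lambda_1 \le \cdots \le \lambda_n$ be the generalized eigenvalues of $\mathbf{A}$ with respect to $\mathbf{M}$, with $\mathbf{M}$-orthonormal generalized eigenvectors $\boldsymbol{\phi}_1, \dots, \boldsymbol{\phi}_n$, and let $\widetilde{\lambda}_1 \le \cdots \le \widetilde{\lambda}_r$ be the generalized eigenvalues of $\widehat{\mathbf{A}} = \mathbf{Q}^\top \mathbf{A}\mathbf{Q}$ with respect to $\widehat{\mathbf{M}} = \mathbf{Q}^\top \mathbf{M}\mathbf{Q}$. Let $\mathbf{P}_{\mathbf{A}} = \mathbf{Q}\widehat{\mathbf{A}}^{-1}\mathbf{Q}^\top\mathbf{A}$, and assume that the $n \times r$ matrix $\mathbf{P}_{\mathbf{A}}[\boldsymbol{\phi}_1, \dots, \boldsymbol{\phi}_r]$ has full rank $r$. For $1 \le k \le r$ set $$\kappa_k = \sup_{\mathbf{y} \in \operatorname{span}\{\boldsymbol{\phi}_1,\dots,\boldsymbol{\phi}_k\}\setminus\{\mathbf{0}\}} \frac{\|\mathbf{y}\|_{\mathbf{M}}}{\|\mathbf{P}_{\mathbf{A}}\mathbf{y}\|_{\mathbf{M}}},$$ which is finite. Then for every $1 \le k \le r$, $$\lambda_k \le \widetilde{\lambda}_k \le \kappa_k^2 \lambda_k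 .$$
   Context: All matrices and vectors are real. For a symmetric matrix $\mathbf{A}$ and a symmetric positive definite matrix $\mathbf{M}$ in $\mathbb{R}^{n\times n}$, a generalized eigenvector of $\mathbf{A}$ with respect to $\mathbf{M}$ with generalized eigenvalue $\lambda\in\mathbb{R}$ is a nonzero $\boldsymbol{\phi}\in\mathbb{R}^n$ with $\mathbf{A}\boldsymbol{\phi} = \lambda\mathbf{M}\boldsymbol{\phi}$. The generalized eigenvalues are listed in ascending order, repeated according to multiplicity, together with a fixed basis $\boldsymbol{\phi}_1,\dots,\boldsymbol{\phi}_n$ of corresponding generalized eigenvectors satisfying $\mathbf{A}\boldsymbol{\phi}_k = \lambda_k \mathbf{M}\boldsymbol{\phi}_k$ and $\boldsymbol{\phi}_i^\top\mathbf{M}\boldsymbol{\phi}_k = \delta_{ik}$. The same conventions apply to the $r\times r$ pair $(\widehat{\mathbf{A}},\widehat{\mathbf{M}})$. The $\mathbf{M}$-induced norm is $\|\mathbf{x}\|_{\mathbf{M}} = \sqrt{\mathbf{x}^\top\mathbf{M}\mathbf{x}}$. *)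

(* Defs.v *)
From HB Require Import structures.
From mathcomp Require Import all_boot all_order all_algebra.
From mathcomp Require Import all_classical all_reals.

Set Implicit Arguments.
Unset Strict Implicit.
Unset Printing Implicit Defensive.

Import Order.TTheory GRing.Theory Num.Theory.

Local Open Scope classical_set_scope.
Local Open Scope ring_scope.

Definition spd (R : realType) (n : nat) (M : 'M[R]_n) : Prop :=
  M^T = M /\ forall x : 'cV[R]_n, x != 0 -> 0 < (x^T *m M *m x) 0 0.

Definition mnorm (R : realType) (n : nat) (M : 'M[R]_n) (x : 'cV[R]_n) : R :=
  Num.sqrt ((x^T *m M *m x) 0 0).

(* The M-orthonormality of n vectors of R^n makes phi a basis, so lam lists all
   generalized eigenvalues of A with respect to M, with multiplicity. *)
Definition gen_eigensystem (R : realType) (n : nat) (A M : 'M[R]_n)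
    (lam : 'I_n -> R) (phi : 'I_n -> 'cV[R]_n) : Prop :=
  [/\ forall i j : 'I_n, (i <= j)%N -> lam i <= lam j,
      forall i : 'I_n, A *m phi i = lam i *: (M *m phi i)
    & forall i j : 'I_n, ((phi i)^T *m M *m phi j) 0 0 = (i == j)%:R].

Definition projA (R : realType) (n r : nat) (A : 'M[R]_n) (Q : 'M[R]_(n, r)) :
    'M[R]_n :=
  Q *m invmx (Q^T *m A *m Q) *m Q^T *m A.

Definition first_cols (R : realType) (n r : nat) (hrn : (r <= n)%N)
    (phi : 'I_n -> 'cV[R]_n) : 'M[R]_(n, r) :=
  \matrix_(i < n, j < r) phi (widen_ord hrn j) i 0.

(* Indices start at 0, so this is the span of the first k.+1 vectors. *)
Definition lead_span (R : realType) (n : nat) (phi : 'I_n -> 'cV[R]_n)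
    (k : 'I_n) : {vspace 'cV[R]_n} :=
  <<[seq phi i | i : 'I_n <- enum 'I_n & (i <= k)%N]>>%VS.

Definition kappa_set (R : realType) (n : nat) (M P : 'M[R]_n)
    (phi : 'I_n -> 'cV[R]_n) (k : 'I_n) : set R :=
  [set mnorm M y / mnorm M (P *m y)
     | y in [set y : 'cV[R]_n | y \in lead_span phi k /\ y != 0]].

(* The real sup is a genuine supremum only when the set satisfies has_sup. *)
Definition kappa (R : realType) (n : nat) (M P : 'M[R]_n)
    (phi : 'I_n -> 'cV[R]_n) (k : 'I_n) : R :=
  sup (kappa_set M P phi k).

(* Main.v *)
Require Import Defs.
From HB Require Import structures.
From mathcomp Require Import all_boot all_order all_algebra.
From mathcomp Require Import all_classical all_reals.
From mathcomp Require Import lra.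

Set Implicit Arguments.
Unset Strict Implicit.
Unset Printing Implicit Defensive.

Import Order.TTheory GRing.Theory Num.Theory.

Local Open Scope ring_scope.

(* Courant-Fischer by counting dimensions.  In M-orthonormal eigenvector
   coordinates the form A is diagonal, so its Rayleigh quotient is at most lam_k
   on the span of phi_1..phi_k and at least lam_k on the M-orthogonal complement
   of phi_1..phi_(k-1).  Write Ah, Mh for the compressions of A, M by Q.
   Lower bound: the span of psi_1..psi_k contains a nonzero z with Q z
   M-orthogonal to phi_1..phi_(k-1).  Upper bound: the span of phi_1..phi_k
   contains a nonzero y such that Ah^-1 Q^T A y is Mh-orthogonal to
   psi_1..psi_(k-1), and P_A y has A-energy at most that of y because P_A is the
   A-orthogonal projection onto the range of Q.  The constant kappa_k is finite
   because the rank hypothesis gives P_A a left inverse on the span of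
   phi_1..phi_r. *)

(** * Quadratic forms and positive definite matrices *)

Definition qform (R : realType) (n : nat) (M : 'M[R]_n) (x : 'cV[R]_n) : R :=
  (x^T *m M *m x) 0 0.

Lemma qform_mulmx (R : realType) (n m : nat) (M : 'M[R]_n) (B : 'M[R]_(n, m))
    (x : 'cV[R]_m) :
  qform M (B *m x) = qform (B^T *m M *m B) x.
Proof. by rewrite /qform trmx_mul !mulmxA. Qed.

Lemma qform_diag (R : realType) (n : nat) (d : 'rV[R]_n) (x : 'cV[R]_n) :
  qform (diag_mx d) x = \sum_i d 0 i * x i 0 ^+ 2.
Proof.
rewrite /qform mul_mx_diag mxE; apply: eq_bigr => i _.
by rewrite !mxE mulrAC [x i 0 * x i 0]mulrC -expr2 mulrC.
Qed.

Lemma qform1 (R : realType) (n : nat) (x : 'cV[R]_n) :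
  qform 1%:M x = \sum_i x i 0 ^+ 2.
Proof.
by rewrite /qform mulmx1 mxE; apply: eq_bigr => i _; rewrite !mxE expr2.
Qed.

(** A crude entrywise bound; its only role is to make [kappa] finite, so the size of the constant is
    irrelevant. *)
Lemma qform_le (R : realType) (n : nat) (B : 'M[R]_n) (x : 'cV[R]_n) :
  qform B x <= (\sum_i \sum_j `|B i j|) * qform 1%:M x.
Proof.
have coord_le i : x i 0 ^+ 2 <= qform 1%:M x.
  rewrite qform1 (bigD1 i) //= lerDl; apply: sumr_ge0 => j _; exact: sqr_ge0.
move: coord_le; move: (qform 1%:M x) => N coord_le.
rewrite /qform -mulmxA mxE mulr_suml; apply: ler_sum => i _.
rewrite [(B *m x) i 0]mxE mulr_sumr mulr_suml; apply: ler_sum => j _.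
rewrite !mxE; set a := x i 0; set b := x j 0.
have /(le_trans (ler_norm _)) : `|a * (B i j * b)| <= `|B i j| * N; last by [].
rewrite mulrCA !normrM ler_wpM2l ?normr_ge0 //.
have ha : `|a| ^+ 2 <= N by rewrite real_normK ?num_real //; exact: coord_le.
have hb : `|b| ^+ 2 <= N by rewrite real_normK ?num_real //; exact: coord_le.
(* [|a| * |b| <= N] follows from [(|a| - |b|)^2 >= 0] and the two bounds on squares. *)
nra.
Qed.

Lemma spd_qform_ge0 (R : realType) (n : nat) (M : 'M[R]_n) (x : 'cV[R]_n) :
  spd M -> 0 <= qform M x.
Proof.
move=> [_ hM]; have [->|/hM/ltW //] := eqVneq x 0.
by rewrite /qform mulmx0 mxE.
Qed.

Lemma mnorm_sqr (R : realType) (n : nat) (M : 'M[R]_n) (x : 'cV[R]_n) :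
  spd M -> mnorm M x ^+ 2 = qform M x.
Proof. by move=> hM; rewrite sqr_sqrtr // spd_qform_ge0. Qed.

Lemma mnorm_gt0 (R : realType) (n : nat) (M : 'M[R]_n) (x : 'cV[R]_n) :
  spd M -> x != 0 -> 0 < mnorm M x.
Proof. by move=> [_ hM] /hM hx; rewrite sqrtr_gt0. Qed.

Lemma unitmx_inj (R : realType) (n : nat) (B : 'M[R]_n) :
  (forall x : 'cV[R]_n, B *m x = 0 -> x = 0) -> B \in unitmx.
Proof.
move=> hB; rewrite -unitmx_tr -row_free_unit; apply: inj_row_free => v hv.
apply: trmx_inj; rewrite trmx0; apply: hB.
by rewrite -[LHS]trmxK trmx_mul trmxK hv trmx0.
Qed.

Lemma spd_unitmx (R : realType) (n : nat) (M : 'M[R]_n) :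
  spd M -> M \in unitmx.
Proof.
move=> [_ hM]; apply: unitmx_inj => x hx; apply/eqP/negPn/negP => /hM.
by rewrite -mulmxA hx mulmx0 mxE ltxx.
Qed.

(** Orthonormal columns make [Q] injective, so the compressed form stays definite. *)
Lemma spd_congr (R : realType) (n r : nat) (M : 'M[R]_n) (Q : 'M[R]_(n, r)) :
  spd M -> Q^T *m Q = 1%:M -> spd (Q^T *m M *m Q).
Proof.
move=> [symM hM] hQ; split; first by rewrite !trmx_mul trmxK symM mulmxA.
move=> x x0; rewrite -[X in 0 < X]qform_mulmx; apply: hM.
by apply: contra_neq x0 => Qx0; rewrite -[x]mul1mx -hQ -mulmxA Qx0 mulmx0.
Qed.

(** [P] is self-adjoint for the form [A] and idempotent, so by Pythagoras the energy of [y] minus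
    that of [P *m y] is the energy of [y - P *m y], which is nonnegative. *)
Lemma projA_qform_le (R : realType) (n r : nat) (A : 'M[R]_n)
    (Q : 'M[R]_(n, r)) (y : 'cV[R]_n) :
  spd A -> Q^T *m Q = 1%:M -> qform A (projA A Q *m y) <= qform A y.
Proof.
move=> hA hQ; have [symA _] := hA; have [symH _] := spd_congr hA hQ.
have uH := spd_unitmx (spd_congr hA hQ).
set P := projA A Q.
have trP : P^T = A *m Q *m invmx (Q^T *m A *m Q) *m Q^T.
  by rewrite /P /projA !trmx_mul trmxK trmx_inv symH symA !mulmxA.
have AP : P^T *m A = A *m P by rewrite trP /P /projA !mulmxA.
have APP : A *m P *m P = A *m P.
  rewrite /P /projA; set H := Q^T *m A *m Q; set Hi := invmx H.
  have -> : A *m (Q *m Hi *m Q^T *m A) *m (Q *m Hi *m Q^T *m A)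
    = A *m Q *m (Hi *m H *m Hi) *m Q^T *m A by rewrite /H !mulmxA.
  by rewrite mulVmx // mul1mx !mulmxA.
have := spd_qform_ge0 (y - P *m y) hA.
have -> : y - P *m y = (1%:M - P) *m y by rewrite mulmxBl mul1mx.
rewrite !qform_mulmx AP APP [(1%:M - P)^T]linearB /= trmx1.
rewrite mulmxBl mul1mx AP mulmxBr mulmx1.
rewrite mulmxBl APP subrr subr0.
by rewrite /qform mulmxBr mulmxBl !mxE subr_ge0.
Qed.

(** * Spans of leading vectors *)

Lemma lead_span_ker (R : realType) (n m : nat) (phi : 'I_n -> 'cV[R]_n)
    (k : 'I_n) (B : 'M[R]_(m, n)) (y : 'cV[R]_n) :
  (forall i : 'I_n, (i <= k)%N -> B *m phi i = 0) ->
  y \in lead_span phi k -> B *m y = 0.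
Proof.
move=> hB hy.
suff /subvP/(_ y hy) : (lead_span phi k <= lker (linfun (mulmx B)))%VS.
  by rewrite memv_ker lfunE => /eqP.
apply/span_subvP => _ /mapP[i + ->]; rewrite mem_filter => /andP[ik _].
by rewrite memv_ker lfunE /= hB.
Qed.

Lemma first_cols_delta (R : realType) (n r : nat) (hrn : (r <= n)%N)
    (phi : 'I_n -> 'cV[R]_n) (i : 'I_r) :
  first_cols hrn phi *m delta_mx i 0 = phi (widen_ord hrn i).
Proof. by rewrite -colE; apply/colP => j; rewrite !mxE. Qed.

Lemma lead_span_mem (R : realType) (n : nat) (phi : 'I_n -> 'cV[R]_n)
    (k i : 'I_n) :
  (i <= k)%N -> phi i \in lead_span phi k.
Proof.
by move=> ik; apply/memv_span/map_f; rewrite mem_filter ik mem_enum.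
Qed.

Lemma first_cols_lead_span (R : realType) (n : nat) (phi : 'I_n -> 'cV[R]_n)
    (k : 'I_n) (c : 'cV[R]_k.+1) :
  first_cols (ltn_ord k) phi *m c \in lead_span phi k.
Proof.
rewrite [c]matrix_sum_delta mulmx_sumr memv_suml // => i _.
rewrite big_ord1 -scalemxAr first_cols_delta.
apply/memvZ/lead_span_mem; exact: leq_ord.
Qed.

(** * Coordinates in the eigenvector basis *)

Definition cols_mx (R : realType) (n : nat) (phi : 'I_n -> 'cV[R]_n) : 'M[R]_n :=
  \matrix_(i, j) phi j i 0.

Lemma col_cols_mx (R : realType) (n : nat) (phi : 'I_n -> 'cV[R]_n) (i : 'I_n) :
  col i (cols_mx phi) = phi i.
Proof. by apply/colP => j; rewrite !mxE. Qed.

Lemma eigen_orth (R : realType) (n : nat) (A M : 'M[R]_n)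
    (lam : 'I_n -> R) (phi : 'I_n -> 'cV[R]_n) :
  gen_eigensystem A M lam phi -> (cols_mx phi)^T *m M *m cols_mx phi = 1%:M.
Proof.
move=> [_ _ orth]; apply/matrixP => i j; rewrite [RHS]mxE -orth.
by rewrite -!col_cols_mx tr_col -!row_mul colE mulmxA -colE !mxE.
Qed.

(** Column by column, the eigenvector equations say $A\Phi = M\Phi\Lambda$; multiply by $\Phi^T$ and
    use orthonormality. *)
Lemma eigen_diag (R : realType) (n : nat) (A M : 'M[R]_n)
    (lam : 'I_n -> R) (phi : 'I_n -> 'cV[R]_n) :
  gen_eigensystem A M lam phi ->
  (cols_mx phi)^T *m A *m cols_mx phi = diag_mx (\row_i lam i).
Proof.
move=> hlam; have [_ eig _] := hlam.
have -> : (cols_mx phi)^T *m A *m cols_mx phi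
    = (cols_mx phi)^T *m M *m cols_mx phi *m diag_mx (\row_i lam i).
  rewrite -!mulmxA; congr (_ *m _); rewrite mulmxA; apply/matrixP => i j.
  rewrite mul_mx_diag [RHS]mxE [X in _ * X]mxE mulrC.
  have /colP/(_ i) := eig j; rewrite -(col_cols_mx phi j) [RHS]mxE !colE.
  by rewrite !mulmxA -!colE ![col _ _ _ _]mxE.
by rewrite (eigen_orth hlam) mul1mx.
Qed.

(** For square matrices a left inverse is a right inverse, so $\Phi^T M \Phi = I$ gives $\Phi\Phi^T
    M = I$: the coordinates of $x$ are $\phi_i^T M x$. *)
Lemma eigen_expand (R : realType) (n : nat) (A M : 'M[R]_n)
    (lam : 'I_n -> R) (phi : 'I_n -> 'cV[R]_n) (x : 'cV[R]_n) :
  gen_eigensystem A M lam phi -> x = cols_mx phi *m ((cols_mx phi)^T *m M *m x).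
Proof.
by move=> hlam; rewrite mulmxA (mulmx1C (eigen_orth hlam)) mul1mx.
Qed.

Lemma eigen_qformM (R : realType) (n : nat) (A M : 'M[R]_n)
    (lam : 'I_n -> R) (phi : 'I_n -> 'cV[R]_n) (x : 'cV[R]_n) :
  gen_eigensystem A M lam phi ->
  qform M x = \sum_i (((phi i)^T *m M *m x) 0 0) ^+ 2.
Proof.
move=> hlam; rewrite {1}(eigen_expand x hlam) qform_mulmx (eigen_orth hlam).
rewrite qform1.
apply: eq_bigr => i _; rewrite -col_cols_mx tr_col -!row_mul.
by rewrite [in RHS]mxE.
Qed.

Lemma eigen_qformA (R : realType) (n : nat) (A M : 'M[R]_n)
    (lam : 'I_n -> R) (phi : 'I_n -> 'cV[R]_n) (x : 'cV[R]_n) :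
  gen_eigensystem A M lam phi ->
  qform A x = \sum_i lam i * (((phi i)^T *m M *m x) 0 0) ^+ 2.
Proof.
move=> hlam; rewrite {1}(eigen_expand x hlam) qform_mulmx (eigen_diag hlam).
rewrite qform_diag; apply: eq_bigr => i _; rewrite -col_cols_mx tr_col -!row_mul.
by rewrite mxE [in RHS]mxE.
Qed.

(** * Rayleigh quotient bounds and the dimension count *)

Lemma eigen_lead_span_le (R : realType) (n : nat) (A M : 'M[R]_n)
    (lam : 'I_n -> R) (phi : 'I_n -> 'cV[R]_n) (k : 'I_n) (x : 'cV[R]_n) :
  gen_eigensystem A M lam phi -> x \in lead_span phi k ->
  qform A x <= lam k * qform M x.
Proof.
move=> hlam hx; have [mono _ orth] := hlam.
rewrite (eigen_qformA x hlam) (eigen_qformM x hlam) mulr_sumr.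
apply: ler_sum => i _; have [ik|ki] := leqP i k.
  by rewrite ler_wpM2r ?sqr_ge0 // mono.
(* For [i > k] the coordinate of [x] along [phi i] vanishes, by orthogonality to the spanning
   vectors. *)
rewrite [_ *m x](lead_span_ker _ hx) ?mxE ?expr0n ?mulr0 // => j jk.
apply/matrixP => a b; rewrite !ord1 orth mxE.
by case: eqP => // ij; move: ki; rewrite ij ltnNge jk.
Qed.

Lemma eigen_orth_ge (R : realType) (n : nat) (A M : 'M[R]_n)
    (lam : 'I_n -> R) (phi : 'I_n -> 'cV[R]_n) (k : 'I_n) (x : 'cV[R]_n) :
  gen_eigensystem A M lam phi ->
  (forall i : 'I_n, (i < k)%N -> (phi i)^T *m M *m x = 0) ->
  lam k * qform M x <= qform A x.
Proof.
move=> hlam hx; have [mono _ _] := hlam.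
rewrite (eigen_qformA x hlam) (eigen_qformM x hlam) mulr_sumr.
apply: ler_sum => i _; have [ki|ik] := leqP k i.
  by rewrite ler_wpM2r ?sqr_ge0 // mono.
by rewrite hx // mxE expr0n /= !mulr0.
Qed.

(** With indices from 0 the leading span has dimension [k.+1], while [D] imposes only [k] linear
    conditions. *)
Lemma eigen_lead_span_kernel (R : realType) (n : nat) (A M : 'M[R]_n)
    (lam : 'I_n -> R) (phi : 'I_n -> 'cV[R]_n) (k : 'I_n) (D : 'M[R]_(k, n)) :
  gen_eigensystem A M lam phi ->
  exists y : 'cV[R]_n, [/\ y \in lead_span phi k, y != 0 & D *m y = 0].
Proof.
move=> hlam; set F := first_cols (ltn_ord k) phi.
have F_orth : F^T *m M *m F = 1%:M.
  have [_ _ orth] := hlam; apply/matrixP => i j; rewrite [RHS]mxE.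
  have -> : (i == j) = (widen_ord (ltn_ord k) i == widen_ord (ltn_ord k) j) by [].
  rewrite -orth -!first_cols_delta trmx_mul trmx_delta -!mulmxA -rowE !mulmxA.
  by rewrite -colE ![RHS]mxE [LHS]mxE.
have F_inj (c : 'cV_k.+1) : F *m c = 0 -> c = 0.
  by move=> Fc; rewrite -[c]mul1mx -F_orth -mulmxA Fc mulmx0.
(* [kermx] is a left kernel, hence the transpose, which has [k.+1] rows and rank at most [k]. *)
have : kermx (D *m F)^T != 0.
  rewrite kermx_eq0 /row_free neq_ltn; apply/orP; left.
  by rewrite ltnS rank_leq_col.
move=> /rowV0Pn[v /sub_kermxP vDF v0].
exists (F *m v^T); split; first exact: first_cols_lead_span.
  by apply: contra_neq v0 => /F_inj v0; apply: trmx_inj; rewrite v0 trmx0.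
by apply: trmx_inj; rewrite mulmxA trmx_mul trmxK vDF trmx0.
Qed.

Lemma eigen_neq0 (R : realType) (n : nat) (A M : 'M[R]_n)
    (lam : 'I_n -> R) (phi : 'I_n -> 'cV[R]_n) (i : 'I_n) :
  gen_eigensystem A M lam phi -> phi i != 0.
Proof.
move=> [_ _ orth]; apply/eqP => phi0; have := orth i i.
by rewrite phi0 mulmx0 eqxx mxE => /eqP; rewrite eq_sym oner_eq0.
Qed.

Lemma eigen_gt0 (R : realType) (n : nat) (A M : 'M[R]_n)
    (lam : 'I_n -> R) (phi : 'I_n -> 'cV[R]_n) (i : 'I_n) :
  spd A -> gen_eigensystem A M lam phi -> 0 < lam i.
Proof.
move=> [_ hA] hlam; have [_ eig orth] := hlam.
have := hA _ (eigen_neq0 i hlam).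
by rewrite -mulmxA eig -scalemxAr mxE mulmxA orth eqxx mulr1.
Qed.

(** In eigenvector coordinates [M] becomes the identity, so the entrywise bound applies. *)
Lemma eigen_mnorm_bound (R : realType) (n : nat) (A M B : 'M[R]_n)
    (lam : 'I_n -> R) (phi : 'I_n -> 'cV[R]_n) :
  gen_eigensystem A M lam phi ->
  exists2 C : R, 0 <= C & forall x, qform M (B *m x) <= C * qform M x.
Proof.
move=> hlam; set BF := B *m cols_mx phi.
exists (\sum_i \sum_j `|(BF^T *m M *m BF) i j|).
  by do 2![apply: sumr_ge0 => ? _].
move=> x; rewrite {1 2}(eigen_expand x hlam) mulmxA -/BF qform_mulmx.
by rewrite (qform_mulmx _ (cols_mx phi)) (eigen_orth hlam) qform_le.
Qed.

(** * Finiteness of [kappa] and the two eigenvalue inequalities *)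

Theorem theorem4p6 (R : realType) (n r : nat) (hr : (1 <= r)%N)
    (hrn : (r <= n)%N) (A M : 'M[R]_n) (Q : 'M[R]_(n, r))
    (hA : spd A) (hM : spd M) (hQ : Q^T *m Q = 1%:M)
    (lam : 'I_n -> R) (phi : 'I_n -> 'cV[R]_n)
    (hlam : gen_eigensystem A M lam phi)
    (lamt : 'I_r -> R) (psi : 'I_r -> 'cV[R]_r)
    (hlamt : gen_eigensystem (Q^T *m A *m Q) (Q^T *m M *m Q) lamt psi)
    (hrank : \rank (projA A Q *m first_cols hrn phi) = r) :
  forall k : 'I_r,
    let k' := widen_ord hrn k in
    [/\ forall y : 'cV[R]_n, y \in lead_span phi k' -> y != 0 ->
          0 < mnorm M (projA A Q *m y),
        has_sup (kappa_set M (projA A Q) phi k'),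
        lam k' <= lamt k
      & lamt k <= kappa M (projA A Q) phi k' ^+ 2 * lam k'].
Proof.
move=> k k'; set P := projA A Q; set F := first_cols hrn phi.
have hMh := spd_congr hM hQ; have hAh := spd_congr hA hQ.
have [G GPF] : exists G : 'M_(r, n), G *m (P *m F) = 1%:M.
  by apply/row_fullP; rewrite /row_full hrank.
(* [F *m G] undoes [P] on the leading span: this yields both injectivity of [P] there and, with
   boundedness of [F *m G], an upper bound for the ratios. *)
have FGP y : y \in lead_span phi k' -> F *m G *m (P *m y) = y.
  move=> hy; apply/eqP; rewrite -subr_eq0 mulmxA -[X in _ - X]mul1mx -mulmxBl.
  apply/eqP; apply: (lead_span_ker _ hy) => i ik.
  have ir : (i < r)%N := leq_ltn_trans ik (ltn_ord k).
  have -> : phi i = F *m delta_mx (Ordinal ir) 0.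
    by rewrite first_cols_delta; congr phi; apply: val_inj.
  have FGPF : F *m G *m P *m F = F by rewrite -2!mulmxA GPF mulmx1.
  by rewrite mulmxBl mul1mx (mulmxA _ F) FGPF subrr.
have P0 y : y \in lead_span phi k' -> y != 0 -> P *m y != 0.
  by move=> /FGP hy; apply: contra_neq => Py0; rewrite -hy Py0 mulmx0.
have Pgt0 y : y \in lead_span phi k' -> y != 0 -> 0 < mnorm M (P *m y).
  by move=> hy y0; apply: mnorm_gt0 => //; exact: P0.
have hsup : has_sup (kappa_set M P phi k').
  split.
    exists (mnorm M (phi k') / mnorm M (P *m phi k')), (phi k') => //; split.
      exact: lead_span_mem.
    exact: eigen_neq0 hlam.
  have [C C0 hC] := eigen_mnorm_bound (F *m G) hlam.
  exists (Num.sqrt C) => _ [y [hy y0] <-].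
  rewrite ler_pdivrMr ?Pgt0 // -ler_sqr ?nnegrE ?mulr_ge0 ?sqrtr_ge0 //.
  by rewrite exprMn (sqr_sqrtr C0) !mnorm_sqr // -{1}(FGP y hy).
split=> //.
  (* The kernel of [D] consists of the [z] with [Q *m z] M-orthogonal to the [phi] of index below
     [k]. *)
  pose D : 'M[R]_(k, r) := \matrix_(i < k)
    ((phi (widen_ord hrn (widen_ord (ltnW (ltn_ord k)) i)))^T *m M *m Q).
  have [z [hz z0 Dz]] := eigen_lead_span_kernel D hlamt.
  have zgt0 : 0 < qform (Q^T *m M *m Q) z by case: hMh => _; exact.
  rewrite -(ler_pM2r zgt0); apply: le_trans (eigen_lead_span_le hlamt hz).
  rewrite -!qform_mulmx; apply: (eigen_orth_ge hlam) => i ik.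
  rewrite mulmxA; have /(congr1 (row (Ordinal ik))) := Dz.
  rewrite row_mul rowK row0 => <-; congr (_^T *m _ *m _ *m _); congr phi.
  exact: val_inj.
(* [T *m y] is the coordinate vector of [P *m y] in the columns of [Q]; the next [D] tests it
   against the [psi] of index below [k]. *)
pose T := invmx (Q^T *m A *m Q) *m Q^T *m A.
have PT y : P *m y = Q *m (T *m y) by rewrite /P /projA /T !mulmxA.
pose D : 'M[R]_(k, n) := \matrix_(i < k)
  ((psi (widen_ord (ltnW (ltn_ord k)) i))^T *m (Q^T *m M *m Q) *m T).
have [y [hy y0 Dy]] := eigen_lead_span_kernel (D : 'M_(k', n)) hlam.
have ygt0 : 0 < qform M (P *m y) by case: hM => _ h; apply: h; exact: P0.
rewrite -(ler_pM2r ygt0).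
(* The chain is $\tilde\lambda_k \|Py\|_M^2 \le (Py)^T A (Py) \le y^T A y \le \lambda_k \|y\|_M^2
   \le \lambda_k \kappa_k^2 \|Py\|_M^2$, the last step using $\lambda_k > 0$. *)
have le1 : lamt k * qform M (P *m y) <= qform A (P *m y).
  rewrite PT (qform_mulmx M Q) (qform_mulmx A Q).
  apply: (eigen_orth_ge hlamt) => i ik.
  rewrite [LHS](mulmxA _ T y); have /(congr1 (row (Ordinal ik))) := Dy.
  rewrite row_mul rowK row0 => <-; congr (_^T *m _ *m _ *m _); congr psi.
  exact: val_inj.
have le2 := projA_qform_le y hA hQ.
have le3 := eigen_lead_span_le hlam hy.
have le4 : qform M y <= kappa M P phi k' ^+ 2 * qform M (P *m y).
  have le_kappa : mnorm M y <= kappa M P phi k' * mnorm M (P *m y).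
    by rewrite -ler_pdivrMr ?Pgt0 //; apply: sup_upper_bound => //; exists y.
  rewrite -!mnorm_sqr // -exprMn ler_sqr ?nnegrE ?sqrtr_ge0 //.
  exact: le_trans (sqrtr_ge0 _) le_kappa.
apply: le_trans le1 (le_trans le2 (le_trans le3 _)).
by rewrite mulrAC [leRHS]mulrC ler_wpM2l // ltW // (eigen_gt0 _ hA hlam).
Qed.
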